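(* Let $p$ be an odd prime and let $G$ be a finite $p$-group of nilpotency class $5$. Then $\exp(M(G))$ divides $\exp(G)$, where $M(G)=H_2(G,\mathbb{Z})$ is the Schur multiplier of $G$.
   Context: $\exp(X)$ denotes the exponent of a group $X$. The Schur multiplier $M(G)$ is the second integral homology group $H_2(G,\mathbb{Z})$. *)

(* Defs.v *)
From mathcomp Require Import all_boot all_order all_algebra all_fingroup all_solvable.
Set Implicit Arguments. Unset Strict Implicit. Unset Printing Implicit Defensive.
Import GRing.Theory.
Local Open Scope ring_scope.

(* Integral homology H_2(G, Z) (trivial coefficients) of the finite group
   G = [set: gT], computed by the (inhomogeneous) bar complex:
     C_n = Z[G^n] (finitely supported = all functions, G finite),
     d_2 [g|h]   = [h] - [gh] + [g]
     d_3 [g|h|k] = [h|k] - [gh|k] + [g|hk] - [g|h].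
   M(G) = H_2(G,Z) = ker d_2 / im d_3. *)

Section Bar.
Variable gT : finGroupType.

Definition chain1 := {ffun gT -> int}.
Definition chain2 := {ffun gT * gT -> int}.
Definition chain3 := {ffun gT * gT * gT -> int}.

Definition bar_d2 (c : chain2) : chain1 :=
  [ffun x : gT => \sum_(u : gT * gT)
     c u * ((u.2 == x)%:R - ((u.1 * u.2)%g == x)%:R + (u.1 == x)%:R)].

Definition bar_d3 (c : chain3) : chain2 :=
  [ffun y : gT * gT => \sum_(u : gT * gT * gT)
     c u * (((u.1.2, u.2) == y)%:R - (((u.1.1 * u.1.2)%g, u.2) == y)%:R
            + ((u.1.1, (u.1.2 * u.2)%g) == y)%:R - ((u.1.1, u.1.2) == y)%:R)].

Definition bar_cycle2 (z : chain2) : Prop := forall x, bar_d2 z x = 0.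
Definition bar_boundary2 (z : chain2) : Prop := exists c : chain3, bar_d3 c = z.

(* exp(M(G)) divides n  <=>  n kills every class of M(G) = ker d_2 / im d_3,
   i.e. n * z is a boundary for every 2-cycle z. *)
Definition schur_exponent_dvd (n : nat) : Prop :=
  forall z : chain2, bar_cycle2 z -> bar_boundary2 [ffun u => (n%:R * z u) : int].

End Bar.

(* Main.v *)
(** Let [n] be the exponent of [G] and [A] the reduction modulo [|G|] of the group of 2-chains modulo
    boundaries. The classes [[g|h]] form a cocycle with values in [A], which defines a central
    extension [E] of [G] by [A]; it has class at most 6, its [n]-th powers are central, and every
    2-cycle lies in the derived subgroup [E']. Since [|G|] kills [H_2(G,Z)], it suffices that [n]
    kills [E'].

    Write [L_i] for the lower central series of [E]. Expanding [(x [x,z])^n = (x^n)^z = x^n] with an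
    explicit form of Hall's power formula gives [L_i^n = 1] for [i >= 3], and then
    [[x,z]^n = 1] if [p >= 7], [[x,z]^n = [x,z,x,x,x,x]^(-'C(n,5))] if [p = 5], and
    [[x,z]^n = [x,z,x,x]^(-'C(n,3))] modulo ['C(n,3)]-th powers of [L_5] if [p = 3]. As
    [[xy,z]^n = [x,z]^n [y,z]^n] (modulo ['C(n,3)]-th powers of [L_6] if [p = 3]), the right-hand
    side is additive in [x]; comparing multidegrees over ['F_p] makes it trivial for [p = 5], and
    for [p = 3] gives an Engel identity [[y,x,x,z] = 0] in degree 4 of a graded Lie ring over
    ['F_3]. Together with the same identity for [y] in [L_2], obtained from the centrality of
    [(x u)^n], [u] in [L_2], it makes [[a,b,c,d]] alternating modulo the centre; then
    [[[a,b],[c,d]] = 2 [a,b,c,d]] is both symmetric and antisymmetric under exchanging the pairs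
    [(a,b)] and [(c,d)], so everything vanishes in degrees 5 and 6. *)
From HB Require Import structures.
Require Import Defs.
From mathcomp Require Import all_boot all_order all_algebra all_fingroup all_solvable.
From mathcomp Require Import mxabelem.
From mathcomp Require Import ring zify.
Set Implicit Arguments. Unset Strict Implicit. Unset Printing Implicit Defensive.
Import GRing.Theory.
Local Open Scope group_scope.

(** * Weights in the lower central series *)

Section LowerCentralWeights.

Variable gT : finGroupType.
Implicit Types (x y z u v : gT) (i j k : nat).
Local Notation "''L_' n" := (lower_central_at n [set: gT]) (at level 8, n at level 2, format "''L_' n").

(** Induction on [j] by the three subgroups lemma, in the quotient by ['L_(i + j.+2)]. *)
Lemma lcnT_R i j : [~: 'L_i, 'L_j] \subset 'L_(i + j).
Proof.
elim: j i => [|j IHj] i; first by rewrite addn0 lcn0 commg_subl lcn_norm.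
case: j IHj => [|j] IHj; first by rewrite addn1 lcn1 lcnSnS.
have nN (A : {group gT}) : A \subset 'N('L_(i + j.+2)).
  exact: subset_trans (subsetT A) (lcn_norm _ _).
have tq (A B C : {group gT}) : [~: A, B, C] \subset 'L_(i + j.+2) ->
    [~: A / 'L_(i + j.+2), B / 'L_(i + j.+2), C / 'L_(i + j.+2)] = 1.
  move=> sABC; rewrite -!quotientR //; apply/trivgP.
  by rewrite quotient_sub1 // (subset_trans _ (nN [~: A, B, C]%G)).
suffices: [~: 'L_j.+1, [set: gT], 'L_i] \subset 'L_(i + j.+2) by rewrite commGC lcnSn.
rewrite -quotient_sub1 ?(nN [~: 'L_j.+1, [set: gT], 'L_i]%G) // !quotientR //.
apply/trivgP/three_subgroup; apply: tq; last first.
  by rewrite (subset_trans (commSg _ (IHj i))) // (addnS i j.+1) lcnSnS.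
rewrite (commGC [set: gT]) (subset_trans (commSg _ (lcnSnS _ _))) //.
by rewrite (addnS i j.+1) -addSn IHj.
Qed.

(* A named predicate, so that the tactics below can compute weights syntactically. *)
Definition inL k x := x \in 'L_k.

Lemma inL_R i j x y : inL i x -> inL j y -> inL (i + j) [~ x, y].
Proof. by move=> Lx Ly; apply: (subsetP (lcnT_R i j)); rewrite mem_commg. Qed.

Lemma inL_1 x : inL 1 x. Proof. by rewrite /inL lcn1 inE. Qed.

Lemma inL_leq i j x : inL i x -> j <= i -> inL j x.
Proof. by move=> Lx le_ji; apply: subsetP (lcn_sub_leq _ le_ji) x Lx. Qed.

Lemma inL_J i x y : inL i x -> inL i (x ^ y).
Proof. by rewrite /inL memJ_norm // (subsetP (lcn_norm _ _)) ?inE. Qed.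

Lemma inL_M i x y : inL i x -> inL i y -> inL i (x * y).
Proof. exact: groupM. Qed.

Lemma inL_V i x : inL i x -> inL i x^-1.
Proof. by rewrite /inL groupV. Qed.

Lemma inL_X i x n : inL i x -> inL i (x ^+ n).
Proof. exact: groupX. Qed.

End LowerCentralWeights.

(** A hypothesis [inL i e] takes precedence over the shape of [e], so that named commutators keep
    their known weight; anything unrecognised gets weight 1. *)
Ltac weight e :=
  match goal with
  | H : is_true (inL ?i e) |- _ => i
  | _ => lazymatch e with
    | commg ?a ?b => let i := weight a in let j := weight b in constr:((i + j)%N)
    | conjg ?a ?b => weight a
    | ?a * ?b => let i := weight a in let j := weight b in constr:(minn i j)
    | ?a^-1 => weight a
    | ?a ^+ ?n => weight a
    | _ => constr:(1%N)
    end
  end.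

Ltac solve_inL :=
  lazymatch goal with
  | |- is_true (inL ?k ?e) =>
    let i := weight e in
    apply: (@inL_leq _ i k); [ | by [] ];
    first [ assumption | exact: inL_1
      | lazymatch e with
        | commg ?a ?b => apply: inL_R; solve_inL
        | conjg ?a ?b => apply: inL_J; solve_inL
        | ?a * ?b => apply: inL_M; solve_inL
        | ?a^-1 => apply: inL_V; solve_inL
        | ?a ^+ ?n => apply: inL_X; solve_inL
        end ]
  end.

Section ClassSix.

Variable gT : finGroupType.
Implicit Types (x y z u v c : gT) (i j k n : nat).
Hypothesis L7 : forall x, inL 7 x -> x = 1.

Lemma inL_commute i j x y : inL i x -> inL j y -> 6 < i + j -> commute x y.
Proof.
by move=> Lx Ly ij; apply/commgP/eqP/L7; apply: inL_leq (inL_R Lx Ly) ij.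
Qed.

End ClassSix.

Ltac solve_commute L7 :=
  lazymatch goal with
  | |- commute ?x ?y =>
    let i := weight x in let j := weight y in
    apply: (@inL_commute _ L7 i j); [ solve_inL | solve_inL | by [] ]
  end.

(** * Hall's power formula in class six *)

Section PowerFormula.

Variable gT : finGroupType.
Implicit Types (x y z u v c : gT) (i j k n : nat).
Hypothesis L7 : forall x : gT, inL 7 x -> x = 1.

(** What collecting [(x * c) ^+ n] leaves behind [x ^+ n * c ^+ n] when [c] has weight 2 and weights
    above 6 vanish. *)
Definition power_tail n c x :=
  [~ c, x] ^+ 'C(n, 2) * [~ c, x, x] ^+ 'C(n, 3) * [~ c, x, x, x] ^+ 'C(n, 4)
  * [~ c, x, x, x, x] ^+ 'C(n, 5) * [~ c, x, c] ^+ ('C(n, 2) + 2 * 'C(n, 3))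
  * [~ c, x, x, c] ^+ (2 * 'C(n, 3) + 3 * 'C(n, 4)).

(* Hall's formula in class 6. As [c] has weight 2, the commutators in the tail commute with each
   other, so that conjugation by [x] and by [c] acts linearly on their exponents. *)
Lemma expgM_class6 n x c : inL 2 c -> (x * c) ^+ n = x ^+ n * c ^+ n * power_tail n c x.
Proof.
rewrite /power_tail => Lc; set a1 := [~ c, x]; set a2 := [~ a1, x]; set a3 := [~ a2, x].
set a4 := [~ a3, x]; set d1 := [~ a1, c]; set d2 := [~ a2, c].
have La1 : inL 3 a1 by rewrite /a1; solve_inL.
have La2 : inL 4 a2 by rewrite /a2; solve_inL.
have La3 : inL 5 a3 by rewrite /a3; solve_inL.
have La4 : inL 6 a4 by rewrite /a4; solve_inL.
have Ld1 : inL 5 d1 by rewrite /d1; solve_inL.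
have Ld2 : inL 6 d2 by rewrite /d2; solve_inL.
pose M e1 e2 e3 e4 e5 e6 :=
  a1 ^+ e1 * (a2 ^+ e2 * (a3 ^+ e3 * (a4 ^+ e4 * (d1 ^+ e5 * d2 ^+ e6)))).
have MM e1 e2 e3 e4 e5 e6 f1 f2 f3 f4 f5 f6 :
    M e1 e2 e3 e4 e5 e6 * M f1 f2 f3 f4 f5 f6 =
    M (e1 + f1) (e2 + f2) (e3 + f3) (e4 + f4) (e5 + f5) (e6 + f6).
  have mulXX (u v w : gT) e f : commute v u ->
    (u ^+ e * v) * (u ^+ f * w) = u ^+ (e + f) * (v * w).
    by move=> cvu; rewrite expgD !mulgA -(mulgA (u ^+ e)) (commuteX f cvu) !mulgA.
  rewrite /M; do 5![rewrite mulXX; last by solve_commute L7].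
  by rewrite -expgD.
have MX e1 e2 e3 e4 e5 e6 m : M e1 e2 e3 e4 e5 e6 ^+ m =
    M (e1 * m)%N (e2 * m)%N (e3 * m)%N (e4 * m)%N (e5 * m)%N (e6 * m)%N.
  elim: m => [|m IHm]; first by rewrite !muln0 /M !expg0 !mulg1.
  by rewrite expgSr IHm MM !mulnSr.
have J5 v w : inL 5 v -> inL 2 w -> v ^ w = v.
  by move=> Lv Lw; rewrite conjg_mulR [[~ v, w]]L7 ?mulg1 //; solve_inL.
have MJ e1 e2 e3 e4 e5 e6 : M e1 e2 e3 e4 e5 e6 ^ x =
    M e1 (e1 + e2) (e2 + e3) (e3 + e4) e5 (e5 + e6).
  have aJ1 : a1 ^ x = (M 1 1 0 0 0 0)%N by rewrite /M !expg0 !expg1 !mulg1 conjg_mulR.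
  have aJ2 : a2 ^ x = (M 0 1 1 0 0 0)%N.
    by rewrite /M !expg0 !expg1 !mulg1 mul1g conjg_mulR.
  have aJ3 : a3 ^ x = (M 0 0 1 1 0 0)%N.
    by rewrite /M !expg0 !expg1 !mulg1 !mul1g conjg_mulR.
  have aJ4 : a4 ^ x = (M 0 0 0 1 0 0)%N.
    rewrite /M !expg0 !expg1 !mulg1 !mul1g conjg_mulR.
    by rewrite [[~ a4, x]]L7 ?mulg1 //; solve_inL.
  (* In class six [[~ c, x, c, x] = [~ c, x, x, c]], so conjugation by [x] brings in no further
     commutator. *)
  have dJ1 : d1 ^ x = (M 0 0 0 0 1 1)%N.
    rewrite /M !expg0 !expg1 !mul1g {1}/d1 conjRg !conjg_mulR -/a1 -/a2.
    rewrite commMgJ (commgMJ a1 c) (commgMJ a2 c) commgg mul1g [[~ a2, a1]]L7 ?mul1g; last by solve_inL.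
    by rewrite -/d1 -/d2 !J5 ?mulg1 //; solve_inL.
  have dJ2 : d2 ^ x = (M 0 0 0 0 0 1)%N.
    rewrite /M !expg0 !expg1 !mul1g conjg_mulR.
    by rewrite [[~ d2, x]]L7 ?mulg1 //; solve_inL.
  rewrite {1}/M !conjMg !conjXg aJ1 aJ2 aJ3 aJ4 dJ1 dJ2 !MX !MM.
  by congr M; rewrite ?(mul0n, mul1n, add0n, addn0).
have Mc e1 e2 e3 e4 e5 e6 : M e1 e2 e3 e4 e5 e6 * c =
    c * M e1 e2 e3 e4 (e1 + e5) (e2 + e6).
  rewrite -[LHS](mulKVg c) -conjgE; congr (_ * _).
  have aJ1 : a1 ^ c = (M 1 0 0 0 1 0)%N.
    by rewrite /M !expg0 !expg1 !mulg1 !mul1g conjg_mulR.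
  have aJ2 : a2 ^ c = (M 0 1 0 0 0 1)%N.
    by rewrite /M !expg0 !expg1 !mul1g conjg_mulR.
  have aJ3 : a3 ^ c = (M 0 0 1 0 0 0)%N by rewrite J5 // /M !expg0 !expg1 !mulg1 !mul1g.
  have aJ4 : a4 ^ c = (M 0 0 0 1 0 0)%N.
    by rewrite J5 /M ?expg0 ?expg1 ?mulg1 ?mul1g //; solve_inL.
  have dJ1 : d1 ^ c = (M 0 0 0 0 1 0)%N by rewrite J5 // /M !expg0 !expg1 !mulg1 !mul1g.
  have dJ2 : d2 ^ c = (M 0 0 0 0 0 1)%N.
    by rewrite J5 /M ?expg0 ?expg1 ?mulg1 ?mul1g //; solve_inL.
  rewrite {1}/M !conjMg !conjXg aJ1 aJ2 aJ3 aJ4 dJ1 dJ2 !MX !MM.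
  by congr M; rewrite ?(mul0n, mul1n, add0n, addn0).
have powJ m : (c ^+ m) ^ x = c ^+ m * (M m 0 0 0 'C(m, 2) 0)%N.
  rewrite conjXg conjg_mulR expMg_Rmul -/a1 -/d1; try solve_commute L7.
  by rewrite /M !expg0 mulg1 !mul1g mulgA.
suffices: (x * c) ^+ n = x ^+ n * c ^+ n * M 'C(n, 2) 'C(n, 3) 'C(n, 4) 'C(n, 5)
    ('C(n, 2) + 2 * 'C(n, 3))%N (2 * 'C(n, 3) + 3 * 'C(n, 4))%N.
  by rewrite /M !mulgA.
elim: n => [|n IHn]; first by rewrite /M !expg0 !mulg1.
rewrite expgSr IHn.
have conj_past (u w : gT) : u * w * (x * c) = u * x * (w ^ x * c).
  by rewrite conjgE !mulgA mulgK.
rewrite -(mulgA (x ^+ n)) conj_past -expgSr conjMg powJ MJ.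
rewrite -(mulgA (c ^+ n)) MM -(mulgA (c ^+ n)) Mc (mulgA (c ^+ n)) -expgSr mulgA.
congr (_ * _); rewrite !binS bin1; congr M; ring.
Qed.

End PowerFormula.

(** * Linear forms on the graded Lie ring *)

Section Functionals.

Variables (gT : finGroupType) (R : comNzRingType).
Implicit Types (x y z u v w a b c d e : gT) (i j k : nat) (chi : gT -> R).
Local Open Scope ring_scope.

(* A linear form on [L_k / L_(k+1)], the degree [k] part of the graded Lie ring of the group. *)
Definition graded_form k chi :=
  (forall x y, inL k x -> inL k y -> chi (x * y)%g = chi x + chi y) /\
  (forall x, inL k.+1 x -> chi x = 0).

Lemma graded_form1 k chi : graded_form k chi -> chi 1%g = 0.
Proof. by case=> _; apply; apply: group1. Qed.

Lemma graded_formV k chi x : graded_form k chi -> inL k x -> chi x^-1%g = - chi x.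
Proof.
move=> fchi Lx; apply/eqP; rewrite -addr_eq0 -(proj1 fchi) //; last exact: inL_V.
by rewrite mulVg (graded_form1 fchi).
Qed.

Lemma graded_formJ k chi x y : graded_form k chi -> inL k x -> chi (x ^ y)%g = chi x.
Proof.
move=> fchi Lx; have Lxy := inL_R Lx (inL_1 y); rewrite addn1 in Lxy.
rewrite conjg_mulR (proj1 fchi) // ?(proj2 fchi _ Lxy) ?addr0 //.
exact: inL_leq Lxy (leqnSn k).
Qed.

Lemma graded_formC k chi x y :
  graded_form k chi -> inL k [~ x, y] -> chi [~ y, x] = - chi [~ x, y].
Proof. by move=> fchi Lxy; rewrite -invg_comm (graded_formV fchi). Qed.

Lemma graded_formRl i j chi y : (0 < i)%N -> inL j y ->
  graded_form (i + j)%N chi -> graded_form i (fun x => chi [~ x, y]%g).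
Proof.
move=> i_gt0 Ly fchi; split=> [x x' Lx Lx' | x Lx]; last first.
  by apply: (proj2 fchi); apply: inL_leq (inL_R Lx Ly) _; rewrite addSn.
have [Lxy Lx'y] := (inL_R Lx Ly, inL_R Lx' Ly).
rewrite commMgJ (proj1 fchi) //; last exact: inL_J.
by rewrite (graded_formJ _ fchi).
Qed.

Lemma graded_formRr i j chi x : (0 < j)%N -> inL i x ->
  graded_form (i + j)%N chi -> graded_form j (fun y => chi [~ x, y]%g).
Proof.
move=> j_gt0 Lx fchi; split=> [y y' Ly Ly' | y Ly]; last first.
  by apply: (proj2 fchi); apply: inL_leq (inL_R Lx Ly) _; rewrite addnS.
have [Lxy Lxy'] := (inL_R Lx Ly, inL_R Lx Ly').
rewrite commgMJ (proj1 fchi) //; last exact: inL_J.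
by rewrite (graded_formJ _ fchi) // addrC.
Qed.

(** This is the Hall-Witt identity: [chi] ignores its conjugations and turns its inverses into
    signs. *)
Lemma graded_form_Jacobi i j k chi x y z : (0 < i)%N -> (0 < j)%N -> (0 < k)%N ->
    inL i x -> inL j y -> inL k z -> graded_form (i + j + k)%N chi ->
  chi [~ x, [~ y, z]] = chi [~ x, y, z] - chi [~ x, z, y].
Proof.
move=> i0 j0 k0 Lx Ly Lz fchi.
have V i' j' k' x' y' z' : (0 < i')%N -> (0 < j')%N -> inL i' x' -> inL j' y' -> inL k' z' ->
    (i' + j' + k' = i + j + k)%N -> chi ([~ x', y'^-1, z'] ^ y')%g = - chi [~ x', y', z'].
  move=> i'0 j'0 Lx' Ly' Lz' Dk; have fchi' := fchi; rewrite -Dk in fchi'.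
  rewrite (graded_formJ _ fchi'); last by do 2!apply: inL_R => //; apply: inL_V.
  have f2 := graded_formRl (ltn_addr _ i'0) Lz' fchi'.
  exact: graded_formV (graded_formRr j'0 Lx' f2) Ly'.
have LJ i' j' k' x' y' z' : inL i' x' -> inL j' y' -> inL k' z' ->
    (i' + j' + k' = i + j + k)%N -> inL (i + j + k)%N ([~ x', y'^-1, z'] ^ y').
  by move=> Lx' Ly' Lz' <-; apply/inL_J/inL_R=> //; apply/inL_R=> //; apply: inL_V.
have L1 : inL (i + j + k)%N ([~ x, y^-1, z] ^ y) by apply: (LJ i j k).
have L2 : inL (i + j + k)%N ([~ y, z^-1, x] ^ z) by apply: (LJ j k i) => //; lia.
have L3 : inL (i + j + k)%N ([~ z, x^-1, y] ^ x) by apply: (LJ k i j) => //; lia.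
have := graded_form1 fchi; rewrite -(Hall_Witt_identity x y z).
rewrite (proj1 fchi _ _ (inL_M L1 L2) L3) (proj1 fchi _ _ L1 L2).
rewrite (V i j k) // (V j k i) //; last by lia.
rewrite (V k i j) //; last by lia.
rewrite (@graded_formC _ chi x [~ y, z] fchi); last first.
  by rewrite -addnA; do 2!apply: inL_R => //.
have f2 : graded_form (k + i)%N (fun w => chi [~ w, y]).
  by apply: (graded_formRl _ Ly); rewrite ?ltn_addr //; move: fchi; congr graded_form; lia.
have -> : chi [~ z, x, y] = - chi [~ x, z, y].
  by rewrite (graded_formC f2) // addnC; apply: inL_R.
by move=> E; rewrite -[RHS]addr0 -E; ring.
Qed.

End Functionals.

(** * Polarisation of multi-additive maps *)

Section MultiAdditive.

Variables (gT : finGroupType) (R : comNzRingType).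
Implicit Types x y : gT.
Local Open Scope ring_scope.

Definition additive_form (f : gT -> R) := forall x y, f (x * y)%g = f x + f y.

Lemma additive_formV f : additive_form f -> forall x, f x^-1%g = - f x.
Proof.
move=> fM x; have f1 : f 1%g = 0.
  by apply/(@addrI _ (f 1%g)); rewrite -fM mulg1 addr0.
by apply/eqP; rewrite -addr_eq0 -fM mulVg f1.
Qed.

(** Lets [ring] check a proof that [t] vanishes as a combination of two equations with given
    coefficients. *)
Lemma lincomb2 (t l1 r1 l2 r2 c1 c2 : R) : l1 = r1 -> l2 = r2 ->
  t = c1 * (l1 - r1) + c2 * (l2 - r2) -> t = 0.
Proof. by move=> -> -> ->; rewrite !subrr !mulr0 addr0. Qed.

(** Let [P] and [Q] be the parts of the expansion of degree 1 and 2 in [y]. The hypothesis gives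
    [P + Q = 0], and at [y^-1] it gives [- P + Q = 0]; the difference is [2 P = 0]. *)
Lemma cubic_form_additive (T : gT -> gT -> gT -> R) x y :
    (forall b c, additive_form (fun a => T a b c)) ->
    (forall a c, additive_form (fun b => T a b c)) ->
    (forall a b, additive_form (fun c => T a b c)) ->
    (forall t : R, 4 * t = 0 -> t = 0) ->
    (forall x y, T (x * y)%g (x * y)%g (x * y)%g = T x x x + T y y y) ->
  T x x y + T x y x + T y x x = 0.
Proof.
move=> Ma Mb Mc reg4 TD.
have Va b c := additive_formV (Ma b c); have Vb a c := additive_formV (Mb a c).
have Vc a b := additive_formV (Mc a b).
have E1 := TD x y; have E2 := TD x y^-1%g.
rewrite !(Ma, Mb, Mc, Va, Vb, Vc) in E1 E2.
by apply/reg4/(lincomb2 (c1 := 2) (c2 := - 2) E1 E2); ring.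
Qed.

(* If [T_k] is the part of degree [k] in [y] of [T y (x + y) (x + y) (x + y) (x + y)], the
   hypothesis at [y, -y, 2y, -2y] gives [2 (T_1 + T_3) = 0] and [2 (2 T_1 + 8 T_3) = 0], whence
   [12 T_1 = 0]; and [T_1 = T y x x x x]. *)
Lemma quartic_form_invariant (T : gT -> gT -> gT -> gT -> gT -> R) x y :
    (forall a b c d, additive_form (fun z => T z a b c d)) ->
    (forall z b c d, additive_form (fun a => T z a b c d)) ->
    (forall z a c d, additive_form (fun b => T z a b c d)) ->
    (forall z a b d, additive_form (fun c => T z a b c d)) ->
    (forall z a b c, additive_form (fun d => T z a b c d)) ->
    5 = 0 :> R ->
    (forall z, T z (x * z)%g (x * z)%g (x * z)%g (x * z)%g = T z z z z z) ->
  T y x x x x = 0.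
Proof.
move=> Mz Ma Mb Mc Md char5 TD.
have Vz a b c d := additive_formV (Mz a b c d); have Va z b c d := additive_formV (Ma z b c d).
have Vb z a c d := additive_formV (Mb z a c d); have Vc z a b d := additive_formV (Mc z a b d).
have Vd z a b c := additive_formV (Md z a b c).
have E1 := TD y; have E2 := TD y^-1%g.
have E3 := TD (y * y)%g; have E4 := TD (y * y)^-1%g.
rewrite !(Mz, Ma, Mb, Mc, Md, Vz, Va, Vb, Vc, Vd) in E1 E2 E3 E4.
(* These coefficients eliminate [T_3]: [E] amounts to [- 24 T_1 = 0], to which the last line adds
   [25 T_1 = 0]. *)
have E12 := lincomb2 (c1 := - 16) (c2 := 16) E1 E2 erefl.
have E34 := lincomb2 (c1 := 2) (c2 := - 2) E3 E4 erefl.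
have E := lincomb2 (c1 := 1) (c2 := 1) E12 E34 erefl.
apply: (lincomb2 (c1 := 1) (c2 := 5 * T y x x x x) E char5); ring.
Qed.

End MultiAdditive.

(** * Identities in degrees 4, 5 and 6 of the Lie ring *)

Section LieIdentities.

Variables (gT : finGroupType) (R : comNzRingType).
Implicit Types (x y z u v w a b c d e : gT) (chi : gT -> R).
Local Open Scope ring_scope.

Lemma graded_form_R k chi z : (0 < k)%N ->
  graded_form k.+1 chi -> graded_form k (fun x => chi [~ x, z]).
Proof. by move=> k0; rewrite -addn1; apply: (@graded_formRl _ _ k 1 chi z k0 (inL_1 z)). Qed.

Lemma graded_form_Rr k chi u : graded_form k.+1 chi -> inL k u ->
  graded_form 1 (fun y => chi [~ u, y]).
Proof. by rewrite -(addn1 k) => fchi Lu; apply: (@graded_formRr _ _ k 1 chi u isT Lu). Qed.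

Lemma graded1M chi : graded_form 1 chi -> forall x y, chi (x * y)%g = chi x + chi y.
Proof. by move=> fchi x y; apply: (proj1 fchi); apply: inL_1. Qed.

Section WeightFour.

Variable chi : gT -> R.
Hypothesis fchi : graded_form 4 chi.

Let f3 d := graded_form_R d (isT : (0 < 3)%N) fchi.
Let f2 c d := graded_form_R c (isT : (0 < 2)%N) (f3 d).
Let fa b c d := graded_form_R b (isT : (0 < 1)%N) (f2 c d).
Let fb a c d := graded_form_Rr (f2 c d) (inL_1 a).
Let fc a b d := graded_form_Rr (f3 d) (inL_R (inL_1 a) (inL_1 b)).
Let fd a b c := graded_form_Rr fchi (inL_R (inL_R (inL_1 a) (inL_1 b)) (inL_1 c)).

Lemma graded4_linear :
  [/\ forall a a' b c d, chi [~ (a * a')%g, b, c, d] = chi [~ a, b, c, d] + chi [~ a', b, c, d],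
      forall a b b' c d, chi [~ a, (b * b')%g, c, d] = chi [~ a, b, c, d] + chi [~ a, b', c, d],
      forall a b c c' d, chi [~ a, b, (c * c')%g, d] = chi [~ a, b, c, d] + chi [~ a, b, c', d]
    & forall a b c d d', chi [~ a, b, c, (d * d')%g] = chi [~ a, b, c, d] + chi [~ a, b, c, d']].
Proof.
split=> *.
- exact: (graded1M (fa _ _ _)).
- exact: (graded1M (fb _ _ _)).
- exact: (graded1M (fc _ _ _)).
- exact: (graded1M (fd _ _ _)).
Qed.

Lemma graded4_C a b c d : chi [~ b, a, c, d] = - chi [~ a, b, c, d].
Proof. exact: (graded_formC (f2 c d) (inL_R (inL_1 a) (inL_1 b))). Qed.

(* The part of degree two in [x] of the hypothesis is
   [[z,x,x,y] + [z,x,y,x] + [z,y,x,x] = 0], and in characteristic 3 the left-hand side is the Lie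
   bracket [[z,[y,x,x]]]. *)
Lemma engel_of_additive : (forall t : R, 4 * t = 0 -> t = 0) -> 3 = 0 :> R ->
    (forall x y z, chi [~ (x * y)%g, z, (x * y)%g, (x * y)%g]
        = chi [~ x, z, x, x] + chi [~ y, z, y, y]) ->
  forall x y z, chi [~ y, x, x, z] = 0.
Proof.
move=> reg4 char3 chiD x y z; have [Ma Mb Mc Md] := graded4_linear.
have P : chi [~ z, x, x, y] + chi [~ z, x, y, x] + chi [~ z, y, x, x] = 0.
  rewrite (graded4_C x z x y) (graded4_C x z y x) (graded4_C y z x x) -!opprD.
  rewrite (@cubic_form_additive _ _ (fun a b c => chi [~ a, z, b, c]) x y) ?oppr0 //.
  - by move=> b c v w; apply: Ma.
  - by move=> a c v w; apply: Mc.
  - by move=> a b v w; apply: Md.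
have J1 : chi [~ z, [~ y, x], x] = chi [~ z, y, x, x] - chi [~ z, x, y, x].
  exact: (@graded_form_Jacobi _ _ 1 1 1 _ z y x isT isT isT (inL_1 _) (inL_1 _) (inL_1 _) (f3 x)).
have J2 : chi [~ z, x, [~ y, x]] = chi [~ z, x, y, x] - chi [~ z, x, x, y].
  exact: (@graded_form_Jacobi _ _ 2 1 1 _ _ y x isT isT isT
           (inL_R (inL_1 _) (inL_1 _)) (inL_1 _) (inL_1 _) fchi).
have J3 : chi [~ z, [~ y, x, x]] = chi [~ z, [~ y, x], x] - chi [~ z, x, [~ y, x]].
  exact: (@graded_form_Jacobi _ _ 1 2 1 _ z [~ y, x] x isT isT isT
           (inL_1 _) (inL_R (inL_1 _) (inL_1 _)) (inL_1 _) fchi).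
have C : chi [~ z, [~ y, x, x]] = - chi [~ y, x, x, z].
  apply: (graded_formC fchi).
  exact: (inL_R (inL_R (inL_R (inL_1 y) (inL_1 x)) (inL_1 x)) (inL_1 z)).
rewrite -[LHS]opprK -C J3 J1 J2.
apply: (lincomb2 (c1 := - 1) (c2 := chi [~ z, x, y, x]) P char3).
by move: (chi _) (chi _) (chi _) => t1 t2 t3; ring.
Qed.

End WeightFour.

(** Linearising [chiE] makes entries 2 and 3 anticommute, and [chiI] at [u = [~ x, y]] does so for
    entries 3 and 4. Hence the bracket is alternating in its first four entries, [e] being carried
    along. Then [[[a,b],[c,d]] = 2 [a,b,c,d]] is unchanged by the even permutation that exchanges
    the pairs, while the Lie bracket changes sign, so [4 [a,b,c,d] = 0]. *)
Lemma alternating5_eq0 chi : graded_form 5 chi -> (forall t : R, 4 * t = 0 -> t = 0) ->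
    (forall x y z e, chi [~ y, x, x, z, e] = 0) ->
    (forall x u e, inL 2 u -> chi [~ u, x, x, e] = 0) ->
  forall a b c d e, chi [~ a, b, c, d, e] = 0.
Proof.
move=> fchi reg4 chiE chiI a b c d e.
have fe := graded_form_R e (isT : (0 < 4)%N) fchi; set T := fun x => chi [~ x, e] in fe.
have [Ma Mb Mc Md] := graded4_linear fe.
have Cab := graded4_C fe.
have Cbc x y y' z : T [~ x, y, y', z] = - T [~ x, y', y, z].
  apply/eqP; rewrite -addr_eq0; have := chiE (y * y')%g x z e; rewrite -/(T _).
  by rewrite !(Mb, Mc) /T !chiE add0r addr0 -/(T _) => ->.
have Ccd x y z z' : T [~ x, y, z, z'] = - T [~ x, y, z', z].
  have Lu : inL 2 [~ x, y] := inL_R (inL_1 x) (inL_1 y).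
  apply/eqP; rewrite -addr_eq0; have := chiI (z * z')%g _ e Lu; rewrite -/(T _).
  by rewrite !(Mc, Md) /T !chiI // add0r addr0 -/(T _) => ->.
have J x y z t : T [~ [~ x, y], [~ z, t]] = T [~ x, y, z, t] - T [~ x, y, t, z].
  exact: (@graded_form_Jacobi _ _ 2 1 1 _ _ z t isT isT isT
           (inL_R (inL_1 _) (inL_1 _)) (inL_1 _) (inL_1 _) fe).
have S : T [~ [~ c, d], [~ a, b]] = - T [~ [~ a, b], [~ c, d]].
  by apply: (graded_formC fe); apply: (inL_R (inL_R (inL_1 a) (inL_1 b)) (inL_R (inL_1 c) (inL_1 d))).
apply: reg4; rewrite -/(T _); move: S; rewrite !J.
rewrite (Ccd c d b a) (Ccd a b d c).
have -> : T [~ c, d, a, b] = T [~ a, b, c, d].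
  by rewrite Cbc Cab Ccd Cbc !opprK.
move/eqP; rewrite -subr_eq0 => /eqP <-; ring.
Qed.

(** At [y := w] and [z := x] the first term on the right of the additivity vanishes and
    [[~ x * w, x] = [~ w, x]]; what remains is the hypothesis of [quartic_form_invariant] for
    [[z,x,a,b,c,d]]. *)
Lemma engel5_of_additive chi : graded_form 6 chi -> 5 = 0 :> R ->
    (forall x y z, chi [~ (x * y)%g, z, (x * y)%g, (x * y)%g, (x * y)%g, (x * y)%g]
        = chi [~ x, z, x, x, x, x] + chi [~ y, z, y, y, y, y]) ->
  forall x y, chi [~ x, y, x, x, x, x] = 0.
Proof.
move=> fchi char5 chiD x y.
have f5 w4 := graded_form_R w4 (isT : (0 < 5)%N) fchi.
have f4 w3 w4 := graded_form_R w3 (isT : (0 < 4)%N) (f5 w4).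
have f3 w2 w3 w4 := graded_form_R w2 (isT : (0 < 3)%N) (f4 w3 w4).
have f2 w1 w2 w3 w4 := graded_form_R w1 (isT : (0 < 2)%N) (f3 w2 w3 w4).
have f1 w0 w1 w2 w3 w4 := graded_form_R w0 (isT : (0 < 1)%N) (f2 w1 w2 w3 w4).
have Lu v1 v2 : inL 2 [~ v1, v2] := inL_R (inL_1 v1) (inL_1 v2).
have Lu1 v1 v2 w1 : inL 3 [~ v1, v2, w1] := inL_R (Lu v1 v2) (inL_1 w1).
have Lu2 v1 v2 w1 w2 : inL 4 [~ v1, v2, w1, w2] := inL_R (Lu1 v1 v2 w1) (inL_1 w2).
have Lu3 v1 v2 w1 w2 w3 : inL 5 [~ v1, v2, w1, w2, w3] := inL_R (Lu2 v1 v2 w1 w2) (inL_1 w3).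
have g1 v1 v2 w2 w3 w4 := graded_form_Rr (f3 w2 w3 w4) (Lu v1 v2).
have g2 v1 v2 w1 w3 w4 := graded_form_Rr (f4 w3 w4) (Lu1 v1 v2 w1).
have g3 v1 v2 w1 w2 w4 := graded_form_Rr (f5 w4) (Lu2 v1 v2 w1 w2).
have g4 v1 v2 w1 w2 w3 := graded_form_Rr fchi (Lu3 v1 v2 w1 w2 w3).
apply/eqP; rewrite (graded_formC (f2 x x x x) (Lu y x)) oppr_eq0; apply/eqP.
apply: (@quartic_form_invariant _ _ (fun z a b c d => chi [~ z, x, a, b, c, d])) => //.
- by move=> a b c d v w; apply: (graded1M (f1 x a b c d)).
- by move=> z b c d v w; apply: (graded1M (g1 z x b c d)).
- by move=> z a c d v w; apply: (graded1M (g2 z x a c d)).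
- by move=> z a b d v w; apply: (graded1M (g3 z x a b d)).
- by move=> z a b c v w; apply: (graded1M (g4 z x a b c)).
move=> w; have := chiD x w x; rewrite commMgJ commgg conj1g mul1g !comm1g
  (graded_form1 fchi) add0r; exact.
Qed.

End LieIdentities.

(** * Groups of class six with central powers *)

Lemma dvdn_mul_bin n k : n %| k.+1 * 'C(n, k.+1).
Proof. by rewrite -mul_bin_diag dvdn_mulr. Qed.

Lemma dvdn_bin_coprime p e k : coprime p k.+1 -> p ^ e %| 'C(p ^ e, k.+1).
Proof.
by move=> cpk; have := dvdn_mul_bin (p ^ e) k; rewrite Gauss_dvdr // coprimeXl.
Qed.

(** * Detecting [q]-th powers by linear forms over ['F_p] *)

Section SeparatingForm.

Variables (p : nat) (gT : finGroupType) (A B : {group gT}) (q : nat) (v : gT).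
Hypotheses (p_pr : prime p) (cAA : abelian A) (sBA : B \subset A).
Hypothesis Apq : forall w, w \in A -> w ^+ (p * q) = 1.

(* A coordinate of the elementary abelian group [A^q / B^q], precomposed with [x |-> x^q]. *)
Lemma separating_form : v \in A -> (forall w, w \in B -> w ^+ q <> v ^+ q) ->
  exists chi : gT -> 'F_p,
   [/\ forall x y, x \in A -> y \in A -> chi (x * y) = (chi x + chi y)%R,
       forall x x' y, x \in A -> x' \in A -> y \in B ->
         x ^+ q = x' ^+ q * y ^+ q -> chi x = chi x'
     & chi v <> 0%R].
Proof.
move=> Av notBv.
have fM : {in A &, {morph (fun x => x ^+ q) : x y / x * y}}.
  by move=> x y Ax Ay; apply: expgMn; apply: (centsP cAA).
pose f := Morphism fM; pose E := (f @* A)%G; pose F := (f @* B)%G.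
have cEE : abelian E by apply: morphim_abelian.
have sFE : F \subset E by apply: morphimS.
have nFE : E \subset 'N(F) by apply: sub_abelian_norm.
have abQ : p.-abelem (E / F).
  apply/abelemP=> //; split=> [|_ /morphimP[x nFx Ex ->]]; first exact: quotient_abelian.
  case/morphimP: Ex nFx => y _ Ay -> nFy.
  by rewrite -morphX //= -expgM mulnC Apq // morph1.
have Ev : f v \in E by apply: mem_morphim.
have ntv : coset F (f v) != 1.
  apply/eqP=> /coset_idr Fv.
  have /Fv/morphimP[w Aw Bw Dw] : f v \in 'N(F) by apply: (subsetP nFE).
  exact: notBv Bw (esym Dw).
have ntQ : E / F != 1.
  by apply: contraNneq ntv => Q1; rewrite -in_set1 -[[set 1]]Q1 mem_quotient.
have /rV0Pn[i nz_i] : abelem_rV abQ ntQ (coset F (f v)) != 0%R.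
  rewrite -(abelem_rV_1 abQ ntQ) (inj_in_eq (@abelem_rV_inj _ _ _ abQ ntQ)) ?group1 //.
  exact: mem_quotient.
have fE x : x \in A -> f x \in E by move=> Ax; apply: mem_morphim.
exists (fun x => abelem_rV abQ ntQ (coset F (f x)) 0%R i); split; last exact/eqP.
  move=> x y Ax Ay; rewrite morphM // morphM ?(subsetP nFE) ?fE //.
  by rewrite abelem_rV_M ?mem_quotient ?fE // mxE.
move=> x x' y Ax Ax' By Dx; have -> : f x = f x' * f y by [].
have Ay := subsetP sBA y By; have Fy : f y \in F by apply: mem_morphim; rewrite ?(subsetP sBA).
rewrite (morphM (coset_morphism F)) ?(subsetP nFE) ?fE //.
by rewrite -[coset_morphism F (f y)]/(coset F (f y)) (coset_id Fy) mulg1.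
Qed.

End SeparatingForm.

Section ClassSixExponent.

Variables (gT : finGroupType) (p e : nat).
Implicit Types (x y z u v w a b c d : gT) (i j k : nat).
Hypothesis L7 : forall x : gT, inL 7 x -> x = 1.
Hypotheses (p_pr : prime p) (p_odd : odd p).
Let n := (p ^ e)%N.
Hypothesis cn : forall x y : gT, commute (x ^+ n) y.

Lemma expg_dvd1 x m k : x ^+ m = 1 -> m %| k -> x ^+ k = 1.
Proof. by move=> xm1 /dvdnP[r ->]; rewrite mulnC expgM xm1 expg1n. Qed.

Lemma inL_ind k (P : pred gT) : P 1 ->
    (forall u v, inL k.+2 u -> inL k.+2 v -> P u -> P v -> P (u * v)) ->
    (forall x y, inL k.+1 x -> P [~ x, y]) ->
  forall u, inL k.+2 u -> P u.
Proof.
move=> P1 PM PR u Lu.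
have gS : group_set [set v : gT | inL k.+2 v && P v].
  apply/group_setP; split=> [|v w]; first by rewrite inE /inL group1 P1.
  by rewrite !inE => /andP[Lv Pv] /andP[Lw Pw]; rewrite inL_M ?PM.
suffices /subsetP/(_ u Lu) : 'L_k.+2([set: gT]) \subset Group gS by rewrite inE => /andP[].
rewrite lcnSn gen_subG; apply/subsetP=> _ /imset2P[x y Lx _ ->].
by rewrite inE PR // -addn1 inL_R ?inL_1.
Qed.

Lemma dvd_bin2 : n %| 'C(n, 2).
Proof. by apply: dvdn_bin_coprime; rewrite coprimen2. Qed.

Lemma expg_commutator x y : [~ x, y] ^+ n * power_tail n [~ x, y] x = 1.
Proof.
have Lc : inL 2 [~ x, y] by solve_inL.
apply: (mulgI (x ^+ n)); rewrite mulgA -expgM_class6 // -conjg_mulR -conjXg.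
by rewrite mulg1 conjgE cn mulKg.
Qed.

(** Downward induction from ['L_7 = 1]. For [c] in ['L_k] and [x] in ['L_2] the power tail is
    trivial: [[~ c, x]] has exponent dividing [n] by induction, [n] divides ['C(n, 2)] as [p] is
    odd, and the longer commutators have weight at least 7. The bound [2 < k] puts the left entry of
    a generator of ['L_k] in ['L_2]. *)
Lemma lcn_exponent k u : 2 < k -> inL k u -> u ^+ n = 1.
Proof.
have [j le7] : exists j, 6 < k + j by exists 7; lia.
elim: j k le7 u => [|j IHj] k le7 u k_gt2 Lu.
  by rewrite [u]L7 ?expg1n //; apply: inL_leq Lu _; rewrite -(addn0 k).
have IH w : inL k.+1 w -> w ^+ n = 1 by apply: IHj; rewrite ?addSnnS // ltnW.
have tail1 c x : inL k c -> inL 2 x -> power_tail n c x = 1.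
  move=> Lkc Lx; have Lc : inL 3 c by apply: inL_leq Lkc _.
  have cx1 : [~ c, x] ^+ n = 1.
    by apply/IH/(inL_leq (inL_R Lkc Lx)); rewrite addn2.
  have cxx1 : [~ c, x, x] = 1 by apply: L7; solve_inL.
  have cxc1 : [~ c, x, c] = 1 by apply: L7; solve_inL.
  by rewrite /power_tail (expg_dvd1 cx1 dvd_bin2) cxx1 cxc1 !comm1g !expg1n !mul1g.
case: k => [|[|k]] // in k_gt2 Lu le7 IH tail1 *.
apply/eqP; apply: (inL_ind (P := fun v => v ^+ n == 1)) Lu => [|u' v Lu Lv /eqP u1 /eqP v1|x y Lx].
- by rewrite expg1n.
- by rewrite expgM_class6 ?u1 ?v1 ?tail1 ?mul1g //; apply: (@inL_leq _ k.+2).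
have Lc : inL k.+2 [~ x, y] by rewrite -addn1; apply: inL_R (inL_1 y).
by have := expg_commutator x y; rewrite tail1 ?mulg1 => [->||] //; apply: inL_leq Lx _.
Qed.

Lemma expgMn_commute_L6 u v m : inL 6 u -> (v * u) ^+ m = v ^+ m * u ^+ m.
Proof. by move=> Lu; apply: expgMn; solve_commute L7. Qed.

Lemma abelian_lcn k : 3 < k -> abelian 'L_k([set: gT]).
Proof.
move=> k_gt3; apply/centsP=> x Lx y Ly.
by apply: (@inL_commute _ L7 k k) => //; lia.
Qed.

Lemma inL_eq0 k (F : comNzRingType) (chi : gT -> F) : graded_form k.+2 chi ->
  (forall y x, inL k.+1 x -> chi [~ x, y] = 0%R) -> forall u, inL k.+2 u -> chi u = 0%R.
Proof.
move=> fchi chi0 u Lu; apply/eqP; apply: (inL_ind (P := fun v => chi v == 0%R)) Lu.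
- by rewrite (graded_form1 fchi).
- by move=> v w Lv Lw /eqP v0 /eqP w0; rewrite (proj1 fchi) // v0 w0 addr0.
- by move=> x y Lx; rewrite chi0.
Qed.

(** [separating_form] for ['L_k], abelian since [2 * k > 6], and its subgroup ['L_k.+1]. The second
    clause says that [chi x] depends only on [x ^+ q] modulo [q]-th powers of ['L_k.+1]. *)
Lemma graded_separation k q v : 3 < k -> inL k v ->
    (forall w, inL k w -> w ^+ (p * q) = 1) ->
    (forall w, inL k.+1 w -> w ^+ q <> v ^+ q) ->
  exists chi : gT -> 'F_p,
   [/\ graded_form k chi,
       forall x x' y, inL k x -> inL k x' -> inL k.+1 y ->
         x ^+ q = x' ^+ q * y ^+ q -> chi x = chi x'
     & chi v <> 0%R].
Proof.
move=> k_gt3 Lv kpq nv.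
have [chi [chiM chiE chiv]] := separating_form (B := 'L_k.+1([set: gT])%G) p_pr
  (abelian_lcn k_gt3) (lcn_subS _ _) kpq Lv nv.
have chi1 : chi 1 = 0%R.
  by apply: (@addrI _ (chi 1)); rewrite -chiM ?group1 // mulg1 addr0.
exists chi; split=> //; split=> // x Lx; rewrite -chi1.
by apply: (chiE _ _ x) => //; rewrite ?expg1n ?mul1g ?group1 //; apply: inL_leq Lx _.
Qed.

(** * The case of primes at least 5 *)

Section FiveOrMore.

Hypothesis p_ge5 : 4 < p.
Let q := 'C(n, 5).

(** All commutators of the tail lie in ['L_3], which [n] kills, and [n] divides ['C(n, 2)],
    ['C(n, 3)] and ['C(n, 4)]. *)
Lemma power_tail5 c x : inL 2 c -> power_tail n c x = [~ c, x, x, x, x] ^+ q.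
Proof.
move=> Lc; have cop k : 0 < k < 4 -> n %| 'C(n, k.+1).
  move=> k_lt4; apply: dvdn_bin_coprime; rewrite prime_coprime //; apply/negP=> /dvdn_leq; lia.
have [d2 d3 d4] : [/\ n %| 'C(n, 2), n %| 'C(n, 3) & n %| 'C(n, 4)] by split; apply: cop.
have k1 w m : inL 3 w -> n %| m -> w ^+ m = 1.
  by move=> Lw; apply: expg_dvd1; apply: lcn_exponent Lw.
rewrite /power_tail (k1 _ 'C(n, 2)) ?(k1 _ 'C(n, 3)) ?(k1 _ 'C(n, 4)) //; try solve_inL.
by rewrite !(k1 _ (_ + _)%N) ?mulg1 ?mul1g ?dvdn_add ?dvdn_mull //; solve_inL.
Qed.

Lemma expgM_der5 c d : inL 2 c -> inL 2 d -> (c * d) ^+ n = c ^+ n * d ^+ n.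
Proof.
move=> Lc Ld; rewrite expgM_class6 // power_tail5 //.
by rewrite [X in X ^+ q]L7 ?expg1n ?mulg1 //; solve_inL.
Qed.

(** For [p > 5], [n] divides [q]. For [p = 5], a nontrivial power would be detected by a form [chi]
    of degree 6; comparing [n]-th powers of [[~ a * b, z]], [[~ a, z]] and [[~ b, z]] makes [chi
    [~ a, z, a, a, a, a]] additive in [a], and [engel5_of_additive] applies. *)
Lemma engel5 x y : [~ x, y, x, x, x, x] ^+ q = 1.
Proof.
have Lw a b : inL 6 [~ a, b, a, a, a, a] by solve_inL.
have [cop5 | ] := boolP (coprime p 5).
  apply: expg_dvd1 (dvdn_bin_coprime e cop5).
  by apply: (@lcn_exponent 6) => //; solve_inL.
rewrite prime_coprime // negbK => p5.
have {p5} p5 : p = 5 by apply/eqP; rewrite -dvdn_prime2.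
apply/eqP/idPn=> nv.
have [||||chi [fchi chiE []]] := @graded_separation 6 q [~ x, y, x, x, x, x].
- by [].
- by solve_inL.
- move=> w Lw6; apply: (expg_dvd1 (@lcn_exponent 6 w _ Lw6)) => //.
  by rewrite {1}p5 dvdn_mul_bin.
- by move=> w Lw7; rewrite (L7 Lw7) expg1n => /esym/eqP; apply/negP.
apply: (engel5_of_additive fchi).
  by apply/eqP; rewrite -(@dvdn_pcharf _ p) ?pchar_Fp // p5.
move=> a b z.
have xzV c d : [~ c, d] ^+ n = ([~ c, d, c, c, c, c] ^+ q)^-1.
  apply/eqP; rewrite eq_sym eq_invg_mul; apply/eqP.
  rewrite -(expg_commutator c d) power_tail5; last by solve_inL.
  by change (commute ([~ c, d, c, c, c, c] ^+ q) ([~ c, d] ^+ n)); solve_commute L7.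
have W : [~ a * b, z, a * b, a * b, a * b, a * b] ^+ q =
    ([~ a, z, a, a, a, a] * [~ b, z, b, b, b, b]) ^+ q.
  apply: invg_inj; rewrite -xzV commMgJ expgM_der5; try solve_inL.
  rewrite -conjXg !xzV (@expgMn_commute_L6 [~ b, z, b, b, b, b]) // invMg.
  rewrite conjg_mulR [[~ _, b]]L7 ?mulg1; last by solve_inL.
  change (commute ([~ a, z, a, a, a, a] ^+ q)^-1 ([~ b, z, b, b, b, b] ^+ q)^-1).
  by solve_commute L7.
rewrite -(proj1 fchi) //; apply: (chiE _ _ 1) => //; try solve_inL.
  exact: group1.
by rewrite expg1n mulg1.
Qed.

Lemma commutator_exponent5 x y : [~ x, y] ^+ n = 1.
Proof.
by have := expg_commutator x y; rewrite power_tail5 ?engel5 ?mulg1 //; solve_inL.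
Qed.

End FiveOrMore.

(** * The case of the prime 3 *)

Section Three.

Hypothesis p3 : p = 3.
Let q := 'C(n, 3).

Lemma expg3q k w : 2 < k -> inL k w -> w ^+ (p * q) = 1.
Proof.
by move=> k_gt2 /(lcn_exponent k_gt2) w1; apply: expg_dvd1 w1 _; rewrite {1}p3 dvdn_mul_bin.
Qed.

(** As 2, 4 and 5 are prime to 3, only the multiples of ['C(n, 3)] survive among the exponents. *)
Lemma power_tail3 c x : inL 2 c -> power_tail n c x =
  [~ c, x, x] ^+ q * ([~ c, x, c] ^+ 2 * [~ c, x, x, c] ^+ 2) ^+ q.
Proof.
move=> Lc; have cop k : coprime 3 k.+1 -> n %| 'C(n, k.+1).
  by move=> k3; apply: dvdn_bin_coprime; rewrite p3.
have [d2 d4 d5] : [/\ n %| 'C(n, 2), n %| 'C(n, 4) & n %| 'C(n, 5)] by split; apply: cop.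
have k1 w m : inL 3 w -> n %| m -> w ^+ m = 1.
  by move=> Lw; apply: expg_dvd1; apply: lcn_exponent Lw.
rewrite /power_tail (k1 _ 'C(n, 2)) ?(k1 _ 'C(n, 4)) ?(k1 _ 'C(n, 5)) //; try solve_inL.
have k2 w m : inL 3 w -> n %| m -> w ^+ (m + 2 * q) = (w ^+ 2) ^+ q.
  by move=> Lw nm; rewrite expgD (k1 _ m) // mul1g expgM.
rewrite !mulg1 mul1g k2 ?[(2 * _ + _)%N]addnC ?k2 ?dvdn_mull //; try solve_inL.
rewrite -mulgA (@expgMn _ ([~ c, x, c] ^+ 2)) //.
by solve_commute L7.
Qed.

Lemma expgM_L4 u v m : inL 4 u -> inL 4 v -> (u * v) ^+ m = u ^+ m * v ^+ m.
Proof. by move=> Lu Lv; apply: expgMn; solve_commute L7. Qed.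

Lemma tail_residue c x : inL 2 c -> inL 5 ([~ c, x, c] ^+ 2 * [~ c, x, x, c] ^+ 2).
Proof. by move=> Lc; solve_inL. Qed.

Lemma expg_commutator3 x z : exists2 r, inL 5 r &
  [~ x, z] ^+ n = ([~ x, z, x, x]^-1 * r) ^+ q.
Proof.
have Lc : inL 2 [~ x, z] by solve_inL.
exists ([~ x, z, x, [~ x, z]] ^+ 2 * [~ x, z, x, x, [~ x, z]] ^+ 2)^-1.
  by apply/inL_V/tail_residue.
have := expg_commutator x z; rewrite power_tail3 //.
set r := _ * _ ^+ 2; have Lr : inL 5 r by apply: tail_residue.
rewrite -(@expgM_L4 [~ x, z, x, x]); try solve_inL.
move/eqP; rewrite -eq_invg_mul => /eqP E; rewrite -[LHS]invgK E.
by rewrite -expgVn invMg; congr (_ ^+ _); change (commute r^-1 [~ x, z, x, x]^-1); solve_commute L7.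
Qed.

Lemma expgM_der3 c d : inL 2 c -> inL 2 d ->
  exists2 s, inL 6 s & (c * d) ^+ n = c ^+ n * d ^+ n * s ^+ q.
Proof.
move=> Lc Ld; rewrite expgM_class6 // power_tail3 // -(@expgM_L4 [~ d, c, c]); try solve_inL.
exists ([~ d, c, c] * ([~ d, c, d] ^+ 2 * [~ d, c, c, d] ^+ 2)) => //.
by solve_inL.
Qed.

(** Applying [chi] to the expansion of [[~ x * y, z] ^+ n] kills the corrections [r1], [r2], [r3]
    and [s], all in ['L_5]. So [chi [~ x, z, x, x]] is additive in [x], as [engel_of_additive]
    requires. *)
Lemma engel_form4 (chi : gT -> 'F_p) : graded_form 4 chi ->
    (forall x x' y, inL 4 x -> inL 4 x' -> inL 5 y ->
       x ^+ q = x' ^+ q * y ^+ q -> chi x = chi x') ->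
  forall x y z, chi [~ y, x, x, z] = 0%R.
Proof.
move=> fchi chiE; have char3 : (3 = 0 :> 'F_p)%R.
  by apply/eqP; rewrite -(@dvdn_pcharf _ p) ?pchar_Fp // p3.
apply: engel_of_additive => // [t t0|x y z].
  by have -> : t = (4 * t - 3 * t)%R; [ring | rewrite t0 char3 mul0r subrr].
have [r1 Lr1 E1] := expg_commutator3 (x * y) z.
have [r2 Lr2 E2] := expg_commutator3 x z; have [r3 Lr3 E3] := expg_commutator3 y z.
have [| |s Ls E] := @expgM_der3 ([~ x, z] ^ y) [~ y, z]; try solve_inL.
rewrite -commMgJ -conjXg E1 E2 E3 conjXg in E.
set W := [~ x * y, z, x * y, x * y] in E *; set Wx := [~ x, z, x, x] in E *.
set Wy := [~ y, z, y, y] in E *.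
have [LW LWx LWy] : [/\ inL 4 W, inL 4 Wx & inL 4 Wy].
  by rewrite /W /Wx /Wy; split; solve_inL.
have L5 w : inL 5 w -> inL 4 w /\ chi w = 0%R.
  by move=> Lw; split; [apply: inL_leq Lw _ | apply: (proj2 fchi)].
have [[L1 c1] [L2 c2] [L3 c3]] := And3 (L5 _ Lr1) (L5 _ Lr2) (L5 _ Lr3).
have [Ls4 cs] := L5 _ (inL_leq Ls (isT : 5 <= 6)).
have V w : inL 4 w -> chi w^-1 = (- chi w)%R by apply: graded_formV.
have LWxr : inL 4 ((Wx^-1 * r2) ^ y) by solve_inL.
rewrite -!expgM_L4 in E; try solve_inL.
have cJ : chi ((Wx^-1 * r2) ^ y) = (- chi Wx)%R.
  rewrite (graded_formJ _ fchi); last by solve_inL.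
  by rewrite (proj1 fchi) ?V ?c2 ?addr0 //; solve_inL.
clearbody W Wx Wy.
have LWr : inL 4 (W^-1 * r1) by solve_inL.
have LWr' : inL 4 ((Wx^-1 * r2) ^ y * (Wy^-1 * r3)) by solve_inL.
have := chiE (W^-1 * r1) ((Wx^-1 * r2) ^ y * (Wy^-1 * r3) * s) 1 LWr (inL_M LWr' Ls4).
rewrite expg1n mulg1 => /(_ (group1 _) E).
rewrite (proj1 fchi _ _ LWr' Ls4) (proj1 fchi _ _ LWxr (inL_M (inL_V LWy) L3)) cJ cs.
rewrite (proj1 fchi _ _ (inL_V LWy) L3) (proj1 fchi _ _ (inL_V LW) L1) !V //.
by rewrite c1 c3 !addr0 -opprD => /oppr_inj.
Qed.

(** The contrapositive of [graded_separation]: it turns the vanishing of forms into a move of [q]-th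
    powers one step down the series. *)
Lemma weight_descent k v : 3 < k -> inL k v ->
    (forall chi : gT -> 'F_p, graded_form k chi ->
      (forall x x' y, inL k x -> inL k x' -> inL k.+1 y ->
         x ^+ q = x' ^+ q * y ^+ q -> chi x = chi x') -> chi v = 0%R) ->
  exists2 w, inL k.+1 w & w ^+ q = v ^+ q.
Proof.
move=> k_gt3 Lv chi0.
have [/exists_inP[w Lw /eqP Dw] | /exists_inP nv] :=
    boolP [exists w in 'L_k.+1([set: gT]), w ^+ q == v ^+ q]; first by exists w.
have [||||chi [fchi chiE []]] := @graded_separation k q v => //; last exact: chi0.
  by move=> w; apply: expg3q; apply: ltnW.
by move=> w Lw Dw; case: nv; exists w => //; apply/eqP.
Qed.

Lemma expg_engel4 y x z : exists2 w, inL 5 w & w ^+ q = [~ y, x, x, z] ^+ q.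
Proof.
apply: weight_descent => //; first by solve_inL.
by move=> chi fchi chiE; apply: engel_form4.
Qed.

Lemma expg_engel4_xzxx x z : exists2 w, inL 5 w & w ^+ q = [~ x, z, x, x] ^+ q.
Proof.
apply: weight_descent => //; first by solve_inL.
by move=> chi fchi chiE; rewrite (graded4_C fchi z x) (engel_form4 fchi chiE) oppr0.
Qed.

Lemma commXg_L4 v y : inL 4 v -> [~ v ^+ q, y] = [~ v, y] ^+ q.
Proof. by move=> Lv; apply: commXg; solve_commute L7. Qed.

(* By the power formula, the tail of [(x u)^n] is central. *)
Lemma expg_engel5 u x y : inL 2 u -> exists2 w, inL 6 w & w ^+ q = [~ u, x, x, y] ^+ q.
Proof.
move=> Lu; pose r := [~ u, x, u] ^+ 2 * [~ u, x, x, u] ^+ 2.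
have Lr : inL 5 r by apply: tail_residue.
have tail_y : [~ [~ u, x, x] * r, y] ^+ q = 1.
  rewrite -commXg_L4; last by solve_inL.
  rewrite expgM_L4; try solve_inL.
  rewrite -power_tail3 //; apply/eqP/commgP.
  have -> : power_tail n u x = (x ^+ n * u ^+ n)^-1 * (x * u) ^+ n.
    by rewrite expgM_class6 // mulKg.
  apply: commute_sym; apply: commuteM; last exact/commute_sym/cn.
  by apply/commuteV/commuteM; apply/commute_sym/cn.
exists ([~ r, y]^-1); first by solve_inL.
move: tail_y; rewrite commMgJ.
have -> : [~ u, x, x, y] ^ r = [~ u, x, x, y].
  by rewrite conjg_mulR [[~ _, r]]L7 ?mulg1 //; solve_inL.
rewrite expgM_L4; try solve_inL.
by move/eqP; rewrite mulg_eq1 expgVn => /eqP->.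
Qed.

(** A degree 5 form compatible with [q]-th powers kills every [x] in ['L_5] with [x ^+ q] a [q]-th
    power from ['L_6]. Bracketing [expg_engel4] with one more entry, and [expg_engel5], thus provide
    the two hypotheses of [alternating5_eq0]. *)
Lemma expg_L5 v : inL 5 v -> exists2 w, inL 6 w & w ^+ q = v ^+ q.
Proof.
move=> Lv; apply: weight_descent => // chi fchi chiE.
have char3 : (3 = 0 :> 'F_p)%R by apply/eqP; rewrite -(@dvdn_pcharf _ p) ?pchar_Fp // p3.
have chi0 x y : inL 5 x -> inL 6 y -> y ^+ q = x ^+ q -> chi x = 0%R.
  move=> Lx Ly Dy; rewrite -(graded_form1 fchi); apply: (chiE _ _ y) => //; first exact: group1.
  by rewrite expg1n mul1g.
have T0 a b c d g : chi [~ a, b, c, d, g] = 0%R.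
  apply: (alternating5_eq0 fchi) => [t t0|x y z g'|x u g' Lu].
  - by have -> : t = (4 * t - 3 * t)%R; [ring | rewrite t0 char3 mul0r subrr].
  - have [w Lw Dw] := expg_engel4 y x z; apply: (chi0 _ [~ w, g']); try solve_inL.
    by rewrite -[RHS]commXg_L4 -?Dw ?commXg_L4 //; solve_inL.
  - by have [w Lw Dw] := expg_engel5 x g' Lu; apply: (chi0 _ w) => //; solve_inL.
(* Splitting off the last entry four times reduces ['L_5] to left-normed commutators. *)
have f4 g := graded_form_R g (isT : 0 < 4) fchi.
have f3 d g := graded_form_R d (isT : 0 < 3) (f4 g).
have f2 c d g := graded_form_R c (isT : 0 < 2) (f3 d g).
apply: (inL_eq0 fchi) Lv => g {}v; apply: (inL_eq0 (f4 g)) v => d v.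
apply: (inL_eq0 (f3 d g)) v => c v; apply: (inL_eq0 (f2 c d g)) v => b a _.
exact: T0.
Qed.

(** For [x] in ['L_5] choose [w] in ['L_6] with the same [q]-th power: [[~ x, y] ^+ q =
    [~ w ^+ q, y] = [~ w, y] ^+ q = 1]. So [q] kills ['L_6], hence also ['L_5] by [expg_L5]. *)
Lemma expg_L5_1 v : inL 5 v -> v ^+ q = 1.
Proof.
have L6_1 u : inL 6 u -> u ^+ q = 1.
  move=> Lu; apply/eqP; apply: (inL_ind (P := fun v => v ^+ q == 1)) Lu.
  - by rewrite expg1n.
  - by move=> {u} u w Lu Lw /eqP u1 /eqP w1; rewrite expgM_L4 ?u1 ?w1 ?mulg1 //; solve_inL.
  - move=> x y Lx; have [w Lw Dw] := expg_L5 Lx.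
    rewrite -commXg_L4; last by solve_inL.
    rewrite -Dw commXg_L4; last by solve_inL.
    by rewrite [[~ w, y]]L7 ?expg1n //; solve_inL.
by move=> Lv; have [w Lw <-] := expg_L5 Lv; apply: L6_1.
Qed.

Lemma commutator_exponent3 x y : [~ x, y] ^+ n = 1.
Proof.
have [r Lr ->] := expg_commutator3 x y; have [w Lw Dw] := expg_engel4_xzxx x y.
rewrite expgM_L4; try solve_inL.
by rewrite (expg_L5_1 Lr) mulg1 expgVn -Dw (expg_L5_1 Lw) invg1.
Qed.

End Three.

Lemma der_exponent u : inL 2 u -> u ^+ n = 1.
Proof.
move=> Lu; suffices [mulX commX] :
    (forall c d, inL 2 c -> inL 2 d -> (c * d) ^+ n = c ^+ n * d ^+ n) /\
    (forall x y, [~ x, y] ^+ n = 1).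
  apply/eqP; apply: (inL_ind (P := fun v => v ^+ n == 1)) Lu => [|v w Lv Lw /eqP v1 /eqP w1|x y _].
  - by rewrite expg1n.
  - by rewrite mulX // v1 w1 mulg1.
  - by rewrite commX.
have [p3 | p_ge5] : p = 3 \/ 4 < p.
  have p_gt1 := prime_gt1 p_pr; have p_neq2 : p != 2 by apply: contraTneq p_odd => ->.
  have p_neq4 : p != 4 by apply: contraTneq p_odd => ->.
  by case: (ltngtP p 3) => [||->]; lia.
- split; last exact: commutator_exponent3.
  move=> c d Lc Ld; have [s Ls ->] := expgM_der3 p3 Lc Ld.
  by rewrite (expg_L5_1 p3 (inL_leq Ls (isT : 5 <= 6))) mulg1.
- by split; [exact: expgM_der5 | exact: commutator_exponent5].
Qed.

End ClassSixExponent.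

(** * Central extensions and the bar complex *)

Section CommutativeGroupAsZmodule.

Variables (gT : finGroupType) (cT : commutative (@mulg gT)).

(* The group [gT] in additive notation; the unused argument carries the proof of commutativity to
   the instances. *)
Definition zcopy of commutative (@mulg gT) := gT.

HB.instance Definition _ := Finite.on (zcopy cT).
HB.instance Definition _ :=
  GRing.isZmodule.Build (zcopy cT) (@mulgA gT) cT (@mul1g gT) (@mulVg gT).

End CommutativeGroupAsZmodule.

(** Pairing the coboundary of [s] with [z] is pairing [s] with [bar_d2 z]. *)
Lemma cycle_coboundary (gT : finGroupType) (V : zmodType) (s : gT -> V)
    (z : {ffun gT * gT -> int}) : bar_cycle2 z ->
  (\sum_u (s u.1 + s u.2 - s (u.1 * u.2)%g) *~ z u = 0)%R.
Proof.
move=> cz; have pick g (k : int) : (s g *~ k = \sum_x s x *~ (k * (g == x)%:R))%R.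
  rewrite (bigD1 g) //= eqxx mulr1 big1 ?addr0 // => x.
  by rewrite eq_sym => /negPf->; rewrite mulr0.
under eq_bigr => u _.
  rewrite mulrzBl mulrzDl !pick -sumrN -!big_split /=.
  under eq_bigr => x _ do rewrite -mulrNz -!mulrzDr.
  over.
rewrite exchange_big big1 //= => x _; rewrite -mulrz_sumr.
rewrite (_ : (\sum_u _ = 0)%R) ?mulr0z //.
by have := cz x; rewrite ffunE => {2}<-; apply: eq_bigr => u _; ring.
Qed.

(** * The central extension defined by a cocycle *)

Section CocycleExtension.

Variables (gT : finGroupType) (aT : finZmodType) (f : gT -> gT -> aT).
Local Open Scope ring_scope.

Definition cocycle := forall g h k, f h k + f g (h * k)%g = f (g * h)%g k + f g h.
Hypothesis cocycle_f : cocycle.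

Definition cocycle_ext of cocycle := (gT * aT)%type.
Local Notation E := (cocycle_ext cocycle_f).
HB.instance Definition _ := Finite.on E.

Definition ext_mul (x y : E) : E := ((x.1 * y.1)%g, x.2 + y.2 + f x.1 y.1).
(* [f] is not assumed normalised, whence the terms [f 1 1]. *)
Definition ext_one : E := (1%g, - f 1%g 1%g).
Definition ext_inv (x : E) : E := (x.1^-1%g, - x.2 - f x.1^-1%g x.1 - f 1%g 1%g).

Lemma cocycle1l h : f 1%g h = f 1%g 1%g.
Proof. by have := cocycle_f 1%g 1%g h; rewrite !mul1g => /addrI. Qed.

Lemma cocycle1r h : f h 1%g = f 1%g 1%g.
Proof. by have := cocycle_f h 1%g 1%g; rewrite !mulg1 => /addIr/esym. Qed.

Lemma ext_mulA : associative ext_mul.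
Proof.
move=> x y z; congr (_, _); rewrite /= ?mulgA // !addrA -[LHS]addrA cocycle_f addrA.
by rewrite [in RHS](addrAC _ (f _ _) z.2) addrAC.
Qed.

Lemma ext_mul1 : left_id ext_one ext_mul.
Proof. by case=> g a; congr (_, _); rewrite /= ?mul1g // cocycle1l addrAC addNr add0r. Qed.

Lemma ext_mulV : left_inverse ext_one ext_inv ext_mul.
Proof.
case=> g a; congr (_, _); rewrite /= ?mulVg //.
by rewrite -opprD -addrA addrAC addNr add0r.
Qed.

HB.instance Definition _ := Finite_isGroup.Build E ext_mulA ext_mul1 ext_mulV.

Local Open Scope group_scope.

Definition ext_sec (g : gT) : E := (g, 0%R).
(** The shift by [f 1 1] makes this a homomorphism. *)
Definition ext_in (a : aT) : E := (1, (a - f 1%g 1%g)%R).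
Definition ext_proj (x : E) := x.1.

Lemma ext_projM : {morph ext_proj : x y / x * y}. Proof. by []. Qed.

Lemma ext_inM a b : ext_in (a + b)%R = ext_in a * ext_in b.
Proof. by congr (_, _); rewrite /= ?mulg1 // -[RHS]addrA addrNK addrAC. Qed.

Lemma ext_secM g h : ext_sec g * ext_sec h = ext_in (f g h) * ext_sec (g * h).
Proof. by congr (_, _); rewrite /= ?mul1g // cocycle1l !add0r addr0 addrNK. Qed.

Lemma ext_in_inj : injective ext_in.
Proof. by move=> a b [/addIr]. Qed.

Lemma ext_central x y : ext_proj x = 1 -> commute x y.
Proof.
case: x y => g a [h b] /= ->; congr (_, _); rewrite /= ?mul1g ?mulg1 //.
by rewrite cocycle1l cocycle1r (addrC a).
Qed.

Canonical ext_proj_morphism := @Morphism _ _ [set: E] ext_proj (in2W ext_projM).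

(** The projection kills ['L_c.+1] of the extension, which is therefore central. *)
Lemma ext_lcn c : 'L_c.+1([set: gT]) = 1 -> forall x : E, inL c.+2 x -> x = 1.
Proof.
move=> Lc x Lx; apply/eqP.
apply: (inL_ind (P := fun v : E => v == 1)) Lx => [|u v _ _ /eqP-> /eqP->|y z Ly] /=.
- exact: eqxx.
- by rewrite mulg1.
apply/commgP/ext_central/set1P; rewrite -[[set 1]]Lc.
apply: (subsetP (lcnS c.+1 (subsetT (ext_proj @* [set: E])))).
by rewrite -morphim_lcn // mem_morphim ?inE.
Qed.

Lemma ext_exponent_der (p e c : nat) : prime p -> odd p -> (c <= 5)%N -> 'L_c.+1([set: gT]) = 1 ->
    exponent [set: gT] = (p ^ e)%N ->
  forall a, ext_in a \in [set: E]^`(1) -> (a *+ (p ^ e) = 0)%R.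
Proof.
move=> p_pr p_odd le_c5 Lc expG a Da.
have L7 (x : E) : inL 7 x -> x = 1.
  by move=> Lx; apply: (ext_lcn Lc); apply: inL_leq Lx _.
have cn (x y : E) : commute (x ^+ (p ^ e)) y.
  apply: ext_central; rewrite -[LHS]/(ext_proj_morphism _) morphX ?inE //= -expG.
  by apply: expg_exponent; rewrite inE.
have in1 : ext_in 0%R = 1 by congr (_, _); rewrite add0r.
have inX m : ext_in (a *+ m)%R = ext_in a ^+ m.
  by elim: m => [|m IHm]; rewrite ?mulr0n // mulrSr ext_inM IHm expgSr.
by apply: ext_in_inj; rewrite inX in1; apply: (der_exponent L7).
Qed.


(* Modulo [E'], the element [ext_in (f g h)] is [s g + s h - s (g h)] for [s = ext_sec]. *)
Lemma ext_in_cycle (z : {ffun gT * gT -> int}) : bar_cycle2 z ->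
  ext_in (\sum_u f u.1 u.2 *~ z u)%R \in [set: E]^`(1).
Proof.
move=> cz; pose D := [set: E]^`(1)%G.
have nD x : x \in 'N(D) by rewrite (subsetP (der_norm 1 _)) ?inE.
have cQ : commutative (@mulg (coset_of D)).
  move=> a b; have [[x _ ->] [y _ ->]] := (cosetP a, cosetP b).
  by apply: (centsP (der_abelian 0 [set: E])); rewrite mem_quotient ?inE.
pose tau (x : E) : zcopy cQ := coset D x.
have tauM x y : tau (x * y) = (tau x + tau y)%R by apply: (morphM (coset_morphism D)).
have theta_additive : zmod_morphism (fun a => tau (ext_in a)).
  by move=> a b; rewrite /= -{2}(subrK b a) [in RHS]ext_inM tauM addrK.
pose theta : {additive aT -> zcopy cQ} :=
  HB.pack (fun a => tau (ext_in a)) (GRing.isZmodMorphism.Build _ _ _ theta_additive).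
pose sigma g := tau (ext_sec g).
have sigmaM g h : (theta (f g h) = sigma g + sigma h - sigma (g * h)%g)%R.
  by rewrite -tauM ext_secM tauM addrK.
suffices theta0 : (theta (\sum_u f u.1 u.2 *~ z u) = 0)%R.
  by have := coset_idr (nD _) theta0.
rewrite raddf_sum -[RHS](cycle_coboundary sigma cz); apply: eq_bigr => u _.
by rewrite raddfMz sigmaM.
Qed.

End CocycleExtension.

HB.instance Definition _ (aT : finType) (R : finZmodType) := Finite.on {ffun aT -> R}.

(** * Quotients of finite additive groups *)

Section ZmoduleQuotient.

Variables (W : finZmodType) (B : {group W}).

Lemma zmod_norm (x : W) : x \in 'N(B).
Proof. by rewrite (subsetP (sub_abelian_norm (FinRing.zmod_abelian [set: W]) (subsetT B))) ?inE. Qed.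

Lemma coset_zmodC : commutative (@mulg (coset_of B)).
Proof.
move=> a b; have [[x _ ->] [y _ ->]] := (cosetP a, cosetP b).
by apply: (centsP (quotient_abelian B (FinRing.zmod_abelian [set: W]))); rewrite mem_quotient ?inE.
Qed.

Definition zquot (x : W) : zcopy coset_zmodC := coset B x.

Lemma zquot_zmod_morphism : zmod_morphism zquot.
Proof.
move=> x y; apply: (canRL (addrK _)).
rewrite -[LHS](morphM (coset_morphism B)) ?zmod_norm //=.
by rewrite -[_ * _]/(_ + _)%R subrK.
Qed.

HB.instance Definition _ := GRing.isZmodMorphism.Build W (zcopy coset_zmodC) zquot zquot_zmod_morphism.

Lemma zquot_eq0 x : (zquot x == 0%R) = (x \in B).
Proof. by apply/eqP/idP => [|Bx]; [apply: coset_idr; apply: zmod_norm | apply: coset_id]. Qed.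

End ZmoduleQuotient.

(** * The bar complex and the transfer *)

Section BarComplex.

Variable gT : finGroupType.
Local Open Scope ring_scope.

Definition bar_coef3 (t : gT * gT * gT) (y : gT * gT) : int :=
  ((t.1.2, t.2) == y)%:R - (((t.1.1 * t.1.2)%g, t.2) == y)%:R
  + ((t.1.1, (t.1.2 * t.2)%g) == y)%:R - ((t.1.1, t.1.2) == y)%:R.

Lemma bar_d3E (c : chain3 gT) y : bar_d3 c y = \sum_t c t * bar_coef3 t y.
Proof. by rewrite ffunE. Qed.

Lemma bar_d2D (a b : {ffun gT * gT -> int}) x : bar_d2 (a + b) x = bar_d2 a x + bar_d2 b x.
Proof.
by rewrite !ffunE -big_split; apply: eq_bigr => u _; rewrite ffunE mulrDl.
Qed.

Lemma bar_d2Z k (a : chain2 gT) x : bar_d2 [ffun u => k * a u] x = k * bar_d2 a x.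
Proof. by rewrite !ffunE mulr_sumr; apply: eq_bigr => u _; rewrite ffunE mulrA. Qed.

Lemma bar_d3D (c c' : {ffun gT * gT * gT -> int}) :
  bar_d3 (c + c') = bar_d3 c + bar_d3 c' :> {ffun gT * gT -> int}.
Proof.
apply/ffunP=> y; rewrite !ffunE -big_split; apply: eq_bigr => u _.
by rewrite ffunE mulrDl.
Qed.

Lemma bar_d2d3 (c : chain3 gT) : bar_cycle2 (bar_d3 c).
Proof.
move=> x; rewrite ffunE.
pose e (u : gT * gT) : int := (u.2 == x)%:R - ((u.1 * u.2)%g == x)%:R + (u.1 == x)%:R.
have pick (v : gT * gT) : \sum_u (v == u)%:R * e u = e v.
  rewrite (bigD1 v) //= eqxx mul1r big1 ?addr0 // => u.
  by rewrite eq_sym => /negPf->; rewrite mul0r.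
under eq_bigr => u _ do rewrite bar_d3E mulr_suml -/(e u).
rewrite exchange_big big1 //= => t _.
under eq_bigr => u _.
  rewrite -mulrA /bar_coef3 !(mulrDl, mulNr). over.
rewrite -mulr_sumr !big_split !sumrN /= !pick /e /= mulgA.
by apply/eqP; rewrite mulf_eq0; apply/orP; right; apply/eqP; ring.
Qed.

(* The 3-chain [sum_k sum_(g,h) z(g,h) [k|g|h]] has boundary [|G| z]. *)
Lemma bar_transfer (z : chain2 gT) : bar_cycle2 z ->
  bar_boundary2 [ffun u => #|gT|%:R * z u].
Proof.
move=> cz; exists [ffun t => z (t.1.2, t.2)].
apply/ffunP=> y; rewrite bar_d3E ffunE.
pose triple (p : gT * (gT * gT)) := (p.1, p.2.1, p.2.2).
have triple_bij : bijective triple.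
  by exists (fun t => (t.1.1, (t.1.2, t.2))) => [[k [g h]] | [[k g] h]].
rewrite (reindex triple) /=; last exact: onW_bij.
rewrite -(pair_bigA _ (fun k u => [ffun t : gT * gT * gT => z (t.1.2, t.2)] (triple (k, u))
  * bar_coef3 (triple (k, u)) y)) exchange_big /=.
have pick (s : gT -> gT) w : bijective s -> \sum_k ((s k, w) == y)%:R = (w == y.2)%:R :> int.
  move=> s_bij; case: y => y1 y2 /=; have [-> | neq_w] := eqVneq w y2; last first.
    by apply: big1 => k _; rewrite xpair_eqE (negPf neq_w) andbF.
  have [r rs sr] := s_bij.
  rewrite (bigD1 (r y1)) //= sr eqxx big1 // => k neq_k.
  rewrite xpair_eqE eqxx andbT; case: eqVneq => // Dk.
  by rewrite -Dk rs eqxx in neq_k.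
have id_bij : bijective (@id gT) by exists id.
(* Since [k * g] runs over the group with [k], the last three terms of [d_3 [k|g|h]] sum to minus
   the coefficient of [d_2 [g|h]] at [y.2]; their total against a cycle is zero. *)
have coefE u : \sum_k bar_coef3 (triple (k, u)) y = #|gT|%:R * (u == y)%:R
    - ((u.2 == y.2)%:R - ((u.1 * u.2)%g == y.2)%:R + (u.1 == y.2)%:R).
  rewrite /bar_coef3 /= !big_split !sumrN /= !(pick id) // (pick (mulg^~ u.1)); last first.
    by exists (mulg^~ u.1^-1)%g => k; rewrite ?mulgK ?mulgKV.
  by rewrite sumr_const -surjective_pairing mulr_natl; ring.
have zE k u : [ffun t : gT * gT * gT => z (t.1.2, t.2)] (triple (k, u)) = z u.
  by rewrite ffunE -surjective_pairing.
under eq_bigr => u _.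
  under eq_bigr => k _ do rewrite zE.
  rewrite -mulr_sumr coefE mulrBr. over.
rewrite sumrB /=; have := cz y.2; rewrite ffunE => ->; rewrite subr0.
rewrite (bigD1 y) //= eqxx mulr1 big1 ?addr0 1?mulrC // => u /negPf->.
by rewrite !mulr0.
Qed.

End BarComplex.

(** * Chains modulo [m] and the universal cocycle *)

Section ReductionModulo.

Variables (gT : finGroupType) (m : nat).
Hypothesis m_gt1 : (1 < m)%N.
Local Open Scope ring_scope.

(** Reducing the coefficients makes the kernel of the extension, and so the extension itself,
    finite. *)
Definition chain2_mod : finZmodType := {ffun gT * gT -> 'Z_m}.

Definition bar_d3_mod (c : {ffun gT * gT * gT -> 'Z_m}) : chain2_mod :=
  [ffun y => \sum_t c t * (bar_coef3 t y)%:~R].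

Lemma boundaries_mod_group_set :
  group_set ([set bar_d3_mod c | c : {ffun gT * gT * gT -> 'Z_m}] : {set chain2_mod}).
Proof.
apply/group_setP; split=> [|_ _ /imsetP[c _ ->] /imsetP[c' _ ->]]; apply/imsetP.
  exists 0 => //; apply/ffunP=> y; rewrite !ffunE big1 // => t _.
  by rewrite ffunE mul0r.
exists (c + c') => //; apply/ffunP=> y; rewrite !ffunE -big_split /=.
by apply: eq_bigr => t _; rewrite ffunE mulrDl.
Qed.

Definition boundaries_mod : {group chain2_mod} := Group boundaries_mod_group_set.

Definition unit_chain2 (u : gT * gT) : chain2_mod := [ffun y => (u == y)%:R].

Definition universal_cocycle g h := zquot boundaries_mod (unit_chain2 (g, h)).

(** The identity at [(g, h, k)] says that [d_3 [g|h|k]] is a boundary. *)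
Lemma universal_cocycleP : cocycle universal_cocycle.
Proof.
move=> g h k; apply/eqP; rewrite -subr_eq0 -!raddfD -raddfB zquot_eq0.
apply/imsetP; exists [ffun t => (t == (g, h, k))%:R] => //; apply/ffunP=> y.
rewrite !ffunE (bigD1 (g, h, k)) //= ffunE eqxx mul1r big1 ?addr0; last first.
  by move=> t /negPf neq_t; rewrite ffunE neq_t mul0r.
rewrite /bar_coef3 /= !(rmorphD, rmorphN) /= !rmorph_nat.
by ring.
Qed.

Definition reduction (z : chain2 gT) : chain2_mod := [ffun u => (z u)%:~R].

Lemma sum_universal_cocycle (z : chain2 gT) :
  \sum_u universal_cocycle u.1 u.2 *~ z u = zquot boundaries_mod (reduction z).
Proof.
rewrite (_ : reduction z = \sum_u unit_chain2 u *~ z u).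
  by rewrite raddf_sum; apply: eq_bigr => -[g h] _; rewrite raddfMz.
have ffunMz (f : chain2_mod) (k : int) y : (f *~ k) y = f y *~ k.
  by case: k => k; rewrite ?NegzE ?mulrNz -!pmulrn ?ffunE ffunMnE.
apply/ffunP=> y; rewrite ffunE sum_ffunE (bigD1 y) //= big1 ?addr0 => [|u /negPf neq_u].
  by rewrite ffunMz ffunE eqxx.
by rewrite ffunMz ffunE neq_u mul0rz.
Qed.

Lemma intr_Zp_eq0 (k : int) : (k%:~R == 0 :> 'Z_m) = (m %| k)%Z.
Proof.
have natr0 i : (i%:R == 0 :> 'Z_m) = (m %| i)%N.
  by rewrite -val_eqE /= val_Zp_nat.
by case: k => i; rewrite ?NegzE ?mulrNz ?oppr_eq0 -pmulrn natr0 // dvdzE abszN.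
Qed.

(** Lift the coefficients of a 3-chain modulo [m] to representatives in the integers; [w] is the
    error divided by [m]. *)
Lemma boundary_mod_lift (z : chain2 gT) : reduction z \in boundaries_mod ->
  exists (c : chain3 gT) (w : chain2 gT),
    z = bar_d3 c + [ffun u => m%:R * w u] :> {ffun gT * gT -> int}.
Proof.
case/imsetP=> c _ Dz; pose c' : chain3 gT := [ffun t => (c t : nat)%:Z].
have dvd_m y : (m %| (z y - bar_d3 c' y)%R)%Z.
  rewrite -intr_Zp_eq0 rmorphB /= subr_eq0; apply/eqP.
  have := congr1 (fun f : chain2_mod => f y) Dz; rewrite !ffunE => ->.
  rewrite rmorph_sum; apply: eq_bigr => t _.
  by rewrite rmorphM /= ffunE -pmulrn natr_Zp.
exists c', [ffun y => ((z y - bar_d3 c' y)%R %/ m)%Z]; apply/ffunP=> y.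
rewrite ffunE [X in _ + X]ffunE [X in _ * X]ffunE mulrC natz.
by rewrite divzK ?dvd_m // addrC subrK.
Qed.

End ReductionModulo.

Theorem theorem3p15 (p : nat) (gT : finGroupType) :
  prime p -> odd p ->
  (p.-group [set: gT])%g ->
  nil_class [set: gT] = 5 ->
  schur_exponent_dvd gT (exponent [set: gT]).
Proof.
move=> p_pr p_odd pG clG z cz.
have nilG := pgroup_nil pG.
have L6 : 'L_6([set: gT]) = 1 by apply/(lcn_nil_classP 5 nilG); rewrite clG.
have [e expG] : {e | exponent [set: gT] = (p ^ e)%N}.
  by apply: p_natP; rewrite pnat_exponent.
(* ['Z_m] is the ring of integers modulo [m] only for [m > 1]; class 5 excludes the trivial
   group. *)
have m_gt1 : 1 < #|gT|.
  rewrite -cardsT cardG_gt1; apply/eqP=> G1.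
  by have := abelian1 gT; rewrite -nil_class1 -[X in nil_class X]G1 clG.
pose n := exponent [set: gT].
have := ext_exponent_der (cocycle_f := @universal_cocycleP gT #|gT|) p_pr p_odd (leqnn 5) L6 expG
  (ext_in_cycle _ cz).
rewrite sum_universal_cocycle -expG -/n -raddfMn => /eqP; rewrite zquot_eq0.
have -> : (reduction #|gT| z *+ n = reduction #|gT| [ffun u => n%:R * z u])%R.
  apply/ffunP=> u; rewrite ffunMnE !ffunE rmorphM /= rmorph_nat mulr_natl //.
case/(boundary_mod_lift m_gt1)=> c [w Dz].
(* Here [n z = d_3 c + |G| w], so [|G| d_2 w = 0] over the integers; the transfer then makes [|G| w]
   a boundary. *)
have cw : bar_cycle2 w.
  move=> x; have := bar_d2Z n%:R z x; rewrite cz mulr0 Dz bar_d2D bar_d2d3 add0r bar_d2Z.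
  move/eqP; rewrite mulf_eq0 => /orP[|/eqP//].
  by rewrite natz eqz_nat -(ltn_predK m_gt1).
have [c' Dc'] := bar_transfer cw.
by exists (c + c')%R; rewrite bar_d3D Dc'.
Qed.
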